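(* Let $\mathcal{E} = ((u_i,\omega_i))_{i\in[h]}$ be an exchange economy with $h$ consumers and $\ell$ goods whose utilities $u_i$ are strictly monotonic, continuously differentiable, and $\alpha$-strongly concave (with $\alpha>0$, in the sense and under the standing assumptions of the context), and let $\lambda$ be the Lipschitz constant of the utilities. Let $\varepsilon>0$, and let $n,\kappa$ be positive integers with $$n \ \ge\ \kappa\ \ge\ \frac{16}{\alpha}\left(\frac{\lambda \ell h}{\varepsilon}+\frac{h^2}{\varepsilon^2}\right).$$ Suppose that an allocation $\overline{x}=(\overline{x}_i)_{i\in[h]}\in\mathbb{R}^{h\ell}_+$ belongs to the $\kappa$-core of the $n$-th replica economy $\mathcal{E}^n$. Then $\overline{x}$ is an $\varepsilon$-Walrasian allocation, i.e., there exists a price vector $p\in\Delta$ such that $(p,\overline{x})$ is an $\varepsilon$-Walrasian equilibrium.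
   Context: Notation: $[m]=\{1,\dots,m\}$; $\|\cdot\|$ is the Euclidean norm; $\Delta=\{x\in\mathbb{R}^\ell : x_j\ge 0 \text{ for all } j,\ \sum_j x_j=1\}$. An exchange economy with $h$ consumers and $\ell$ goods is a tuple $\mathcal{E}=((u_i,\omega_i))_{i\in[h]}$, where $\omega_i\in\mathbb{R}^\ell_+$ is the endowment of consumer $i$ and $u_i:\mathbb{R}^\ell_+\to\mathbb{R}$ is its utility function. An allocation is a vector $\overline{x}=(\overline{x}_i)_{i\in[h]}\in\mathbb{R}^{h\ell}_+$ with $\sum_i \overline{x}_i=\sum_i\omega_i$. A coalition is a nonempty set $S$ of consumers; an $S$-allocation is a family $(y_i)_{i\in S}$ of bundles in $\mathbb{R}^\ell_+$ with $\sum_{i\in S}y_i=\sum_{i\in S}\omega_i$. A coalition $S$ blocks an allocation $\overline{x}$ if there is an $S$-allocation $(y_i)_{i\in S}$ with $u_i(y_i)>u_i(\overline{x}_i)$ for all $i\in S$. The $\kappa$-core is the set of allocations not blocked by any coalition of cardinality at most $\kappa$. The $n$-th replica $\mathcal{E}^n$ is the exchange economy with $nh$ consumers indexed by $(i,t)\in[n]\times[h]$, with $u_{i,t}=u_t$ and $\omega_{i,t}=\omega_t$. An allocation of $\mathcal{E}^n$ giving the same bundle to all consumers of the same type is represented by a vector $\overline{x}=(\overline{x}_t)_{t\in[h]}\in\mathbb{R}^{h\ell}_+$ (consumer $(i,t)$ receives $\overline{x}_t$); so $\sum_t\overline{x}_t=\sum_t\omega_t$, and ''$\overline{x}$ belongs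 to the $\kappa$-core of $\mathcal{E}^n$'' means that this replicated allocation does. An $\varepsilon$-Walrasian equilibrium of $\mathcal{E}$ is a pair $(p,\overline{x})$ with $p\in\Delta$ and $\overline{x}$ an allocation such that for every $i\in[h]$: (i) $|p^T\overline{x}_i-p^T\omega_i|\le\varepsilon$; and (ii) for every $y\in\mathbb{R}^\ell_+$ with $u_i(y)>u_i(\overline{x}_i)$ we have $p^Ty>p^T\omega_i-\varepsilon/h$. Standing assumptions on utilities: each $u_i$ is continuous, concave, and $\lambda$-Lipschitz (with respect to $\|\cdot\|$) on $\mathbb{R}^\ell_+$. A differentiable function $u$ is $\alpha$-strongly concave within a set $\mathcal{R}$ if $u(y)\le u(x)+\nabla u(x)^T(y-x)-\frac{\alpha}{2}\|y-x\|^2$ for all $x,y\in\mathcal{R}$ (in the domain of $u$). ''$\alpha$-strongly concave'' for $u_i$ means: $u_i$ is $\alpha$-strongly concave within a set $\mathcal{R}$ containing, for each $i$, the Euclidean ball of radius $r$ centred at $\omega_i$, where $\alpha r^2\ge \frac{2\varepsilon\lambda\ell}{h}+2$. Utilities are normalized: for some $\bar\eta\in(0,1)$, $u_i(x_i)\in[0,1-\bar\eta)$ for every consumer $i$ and every allocation $(x_i)_{i\in[h]}$ of $\mathcal{E}$. *)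

(* Defs.v *)
From mathcomp Require Import all_boot all_order all_algebra.
From mathcomp Require Import all_classical all_reals all_analysis.
Import Order.TTheory GRing.Theory Num.Theory.
Import numFieldNormedType.Exports.

Set Implicit Arguments.
Unset Strict Implicit.
Unset Printing Implicit Defensive.

Local Open Scope classical_set_scope.
Local Open Scope ring_scope.

Definition dotv (R : realType) (l : nat) (x y : 'rV[R]_l) : R :=
  \sum_(j < l) x 0 j * y 0 j.

(* The norm [`|x|] of the library on ['rV[R]_l] is the maximum norm. *)
Definition enorm (R : realType) (l : nat) (x : 'rV[R]_l) : R :=
  Num.sqrt (\sum_(j < l) x 0 j ^+ 2).

Definition eball (R : realType) (l : nat) (c : 'rV[R]_l) (r : R) :
  set 'rV[R]_l := [set x | enorm (x - c) <= r].

Definition orthant (R : realType) (l : nat) : set 'rV[R]_l :=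
  [set x | forall j, 0 <= x 0 j].
Arguments orthant {R l}.

Definition simplex (R : realType) (l : nat) : set 'rV[R]_l :=
  [set x | orthant x /\ \sum_(j < l) x 0 j = 1].
Arguments simplex {R l}.

(** A utility function has domain the nonnegative orthant. It is encoded as a
    total function on ['rV[R]_l]; every property below constrains its values
    on the orthant only. *)
Section Utility.
Variables (R : realType) (l : nat).
Implicit Types (u : 'rV[R]_l -> R) (x y g : 'rV[R]_l).

Definition strictly_monotonic u : Prop :=
  forall x y, orthant x -> orthant y ->
    (forall j, x 0 j <= y 0 j) -> x <> y -> u x < u y.

Definition concave_utility u : Prop :=
  convex_function (orthant : set (convex_lmodType 'rV[R]_l))
    (fun x => - u x).

Definition lipschitz_utility (lambda : R) u : Prop :=
  forall x y, orthant x -> orthant y ->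
    `|u x - u y| <= lambda * enorm (x - y).

(* Differentiability relative to the orthant, so that it also makes sense at
   boundary points, where the gradient is still unique. *)
Definition is_gradient u x g : Prop :=
  (u y - u x - dotv g (y - x)) / enorm (y - x)
    @[y --> within orthant x^'] --> (0 : R).

Definition gradient u x : 'rV[R]_l := xget 0 [set g | is_gradient u x g].

Definition continuously_differentiable u : Prop :=
  (forall x, orthant x -> exists g, is_gradient u x g) /\
  {within orthant, continuous (gradient u)}.

Definition strongly_concave_within (alpha : R) (A : set 'rV[R]_l) u : Prop :=
  forall x y, A x -> A y -> orthant x -> orthant y ->
    u y <= u x + dotv (gradient u x) (y - x)
           - alpha / 2 * enorm (y - x) ^+ 2.

End Utility.

(** The consumers are indexed by an arbitrary finite type, so that the replica
    economies are again economies. *)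
Record economy (R : realType) (l : nat) (I : finType) := Economy {
  util : I -> 'rV[R]_l -> R ;
  endow : I -> 'rV[R]_l ;
  endow_ge0 : forall i, orthant (endow i) }.

Section Economy.
Variables (R : realType) (l : nat) (I : finType).
Implicit Types (E : economy R l I) (x y : I -> 'rV[R]_l) (S : {set I}).

(* Only the values of [y] on the coalition [S] matter. *)
Definition coalition_allocation E S y : Prop :=
  (forall i, i \in S -> orthant (y i)) /\
  \sum_(i in S) y i = \sum_(i in S) endow E i.

Definition allocation E x : Prop :=
  (forall i, orthant (x i)) /\ \sum_i x i = \sum_i endow E i.

Definition blocks E S x : Prop :=
  exists y, coalition_allocation E S y /\
    forall i, i \in S -> util E i (x i) < util E i (y i).

Definition in_core E (kappa : nat) x : Prop :=
  allocation E x /\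
  forall S, (0 < #|S|)%N -> (#|S| <= kappa)%N -> ~ blocks E S x.

Definition walrasian_equilibrium E (eps : R) (p : 'rV[R]_l) x : Prop :=
  [/\ simplex p,
      allocation E x,
      forall i, `|dotv p (x i) - dotv p (endow E i)| <= eps &
      forall i (y : 'rV[R]_l), orthant y -> util E i (x i) < util E i y ->
        dotv p (endow E i) - eps / #|I|%:R < dotv p y].

Definition replica (n : nat) E : economy R l ('I_n * I)%type :=
  {| util := fun it => util E it.2 ;
     endow := fun it => endow E it.2 ;
     endow_ge0 := fun it => endow_ge0 E it.2 |}.

Definition replicate (n : nat) x : 'I_n * I -> 'rV[R]_l := fun it => x it.2.

End Economy.

(* Main.v *)
(** Suppose no price [p] in the simplex satisfies [p.(y - omega_i) > -(3/5) eps/h]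
    for all preferred bundles [y] with [|y - omega_i|^2 <= 9/(2 alpha)].  Playing
    Blackwell's approachability strategy against [p] yields finitely many such
    net trades whose mean is at most [-(11/20) eps/h] in each coordinate, and
    sampling [kappa] of them a la Maurey keeps the sum nonpositive: this is a
    blocking coalition of size [kappa].  So a price exists, and it also supports
    the remote preferred bundles.  Indeed, if [v = y - omega_i] is long, then
    [omega_i - (2/3) v^- + q v^+], for a suitable [q <= 2/3], lies near [omega_i]
    and costs at most 2/3 as much relative to [omega_i], while strong concavity
    and monotonicity give it a utility of at least 1, above the normalization
    bound.  Preferred bundles accumulate at each [x_i], and the net values
    [p.(x_i - omega_i)] sum to zero, which gives the budget condition.
    That [u_i >= 0] below [omega_i] uses a second consumer; with a single one
    [x = omega] and the normalized gradient at [omega] is the price. *)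
Require Import Defs.
From mathcomp Require Import all_boot all_order all_algebra.
From mathcomp Require Import all_classical all_reals all_analysis.
From mathcomp Require Import ring lra.
Import Order.TTheory GRing.Theory Num.Theory.
Import numFieldNormedType.Exports.

Local Open Scope classical_set_scope.
Local Open Scope ring_scope.

(** * Euclidean inner product and norm *)

Section DotProduct.
Context {R : realType} {l : nat}.
Implicit Types (x y z : 'rV[R]_l) (c : R).

Lemma dotvC x y : dotv x y = dotv y x.
Proof. by apply: eq_bigr => j _; rewrite mulrC. Qed.

Lemma dotvDl x y z : dotv (x + y) z = dotv x z + dotv y z.
Proof. by rewrite -big_split; apply: eq_bigr => j _; rewrite mxE mulrDl. Qed.

Lemma dotvZl c x y : dotv (c *: x) y = c * dotv x y.
Proof. by rewrite mulr_sumr; apply: eq_bigr => j _; rewrite mxE mulrA. Qed.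

Lemma dotvNl x y : dotv (- x) y = - dotv x y.
Proof. by rewrite -scaleN1r dotvZl mulN1r. Qed.

Lemma dotvDr x y z : dotv x (y + z) = dotv x y + dotv x z.
Proof. by rewrite dotvC dotvDl !(dotvC x). Qed.

Lemma dotvZr c x y : dotv x (c *: y) = c * dotv x y.
Proof. by rewrite dotvC dotvZl dotvC. Qed.

Lemma dotvNr x y : dotv x (- y) = - dotv x y.
Proof. by rewrite dotvC dotvNl dotvC. Qed.

Lemma dotv0 x : dotv x 0 = 0.
Proof. by apply: big1 => j _; rewrite mxE mulr0. Qed.

Lemma dotv_sumr (I : Type) (s : seq I) (F : I -> 'rV[R]_l) x :
  dotv x (\sum_(i <- s) F i) = \sum_(i <- s) dotv x (F i).
Proof.
elim: s => [|i s IH]; first by rewrite !big_nil dotv0.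
by rewrite !big_cons dotvDr IH.
Qed.

Lemma dotv_ge0 x y : orthant x -> orthant y -> 0 <= dotv x y.
Proof. by move=> x0 y0; apply: sumr_ge0 => j _; rewrite mulr_ge0. Qed.

Lemma dotvv_ge0 x : 0 <= dotv x x.
Proof. by apply: sumr_ge0 => j _; rewrite -expr2 sqr_ge0. Qed.

Lemma sqr_le_dotvv x j : x 0 j ^+ 2 <= dotv x x.
Proof.
rewrite /dotv (bigD1 j) //= -expr2 lerDl.
by apply: sumr_ge0 => k _; rewrite -expr2 sqr_ge0.
Qed.

Lemma enorm_ge0 x : 0 <= enorm x.
Proof. exact: sqrtr_ge0. Qed.

Lemma enorm_sqr x : enorm x ^+ 2 = dotv x x.
Proof.
rewrite sqr_sqrtr; last by apply: sumr_ge0 => j _; exact: sqr_ge0.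
by apply: eq_bigr => j _; rewrite expr2.
Qed.

Lemma enorm_le x c : 0 <= c -> (enorm x <= c) = (dotv x x <= c ^+ 2).
Proof. by move=> c0; rewrite -enorm_sqr ler_pXn2r ?nnegrE ?enorm_ge0. Qed.

Lemma enormZ c x : 0 <= c -> enorm (c *: x) = c * enorm x.
Proof.
move=> c0; rewrite /enorm (eq_bigr (fun j => c ^+ 2 * x 0 j ^+ 2)).
  rewrite -mulr_sumr sqrtrM ?sqr_ge0 // sqrtr_sqr ger0_norm //.
by move=> j _; rewrite mxE exprMn.
Qed.

Lemma enorm_gt0 x : x != 0 -> 0 < enorm x.
Proof.
move=> x0; rewrite lt0r enorm_ge0 andbT; apply: contra x0 => /eqP xx.
apply/eqP/rowP => j; have := sqr_le_dotvv x j.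
rewrite -enorm_sqr xx expr0n /= mxE => h.
by apply/eqP; rewrite -sqrf_eq0 eq_le h sqr_ge0.
Qed.

End DotProduct.

(** * Approachability, and sums of sampled vectors *)

Lemma maxr0D_sqr (R : realDomainType) (a b : R) :
  Num.max 0 (a + b) ^+ 2 <= (Num.max 0 a + b) ^+ 2.
Proof.
have [ab|_] := leP 0 (a + b); last by rewrite expr0n /= sqr_ge0.
by have [//|a0] := leP 0 a; nra.
Qed.

Section Averaging.
Context {R : realType} {l : nat}.
Implicit Types (K : set 'rV[R]_l) (s : seq 'rV[R]_l).

(* Blackwell's approachability strategy: aiming each new point against the
   positive part of the accumulated excess makes its squared norm grow at most
   linearly. *)
Lemma approachability K (C d : R) :
  (forall g, K g -> dotv (g + const_mx d) (g + const_mx d) <= C) ->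
  (forall q, orthant q -> exists2 g, K g & dotv q (g + const_mx d) <= 0) ->
  forall T, exists s, [/\ size s = T, forall g, g \in s -> K g &
    \sum_(j < l) Num.max 0 (\sum_(g <- s) g 0 j + T%:R * d) ^+ 2 <= T%:R * C].
Proof.
move=> KC Kq; elim=> [|T [s [sT sK sC]]].
  exists [::]; split => //; rewrite big1 ?mul0r// => j _.
  by rewrite big_nil addr0 maxxx expr0n.
pose q := \row_j Num.max 0 (\sum_(g <- s) g 0 j + T%:R * d).
have q0 : orthant q by move=> j; rewrite mxE le_max lexx.
have [g Kg qg] := Kq q q0.
exists (g :: s); split => [/=||]; first by rewrite sT.
  by move=> g'; rewrite inE => /orP[/eqP->|/sK].
pose e := g + const_mx d.
have -> : T.+1%:R * C = T%:R * C + C :> R by rewrite -natr1; ring.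
apply: (@le_trans _ _ (dotv (q + e) (q + e))).
  apply: ler_sum => j _; rewrite big_cons -natr1 -expr2 /q /e !mxE.
  set S := \sum_(i <- s) _.
  have -> : g 0 j + S + (T%:R + 1) * d = (S + T%:R * d) + (g 0 j + d) by ring.
  exact: maxr0D_sqr.
rewrite dotvDl (dotvDr q) (dotvDr e) (dotvC e q).
have : dotv q q <= T%:R * C.
  by apply: le_trans sC; apply: ler_sum => j _; rewrite !mxE -expr2.
have eC : dotv e e <= C := KC _ Kg.
have qe : dotv q e <= 0 := qg.
lra.
Qed.

(** A coordinate violating the bound would have an excess above [T * (d - d')] and contribute more
    than [T^2 * (d - d')^2] to a sum bounded by [T * C]; this is impossible once
    [T > C / (d - d')^2]. *)
Lemma approachability_mean K (D d d' : R) : d' < d ->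
  (forall g, K g -> dotv g g <= D) ->
  (forall q, orthant q -> exists2 g, K g & dotv q g <= - d * \sum_j q 0 j) ->
  exists s, [/\ (0 < size s)%N, forall g, g \in s -> K g &
    forall j, \sum_(g <- s) g 0 j <= - d' * (size s)%:R].
Proof.
move=> dd KD Kq.
pose one : 'rV[R]_l := const_mx d.
pose C := 2 * D + 2 * dotv one one.
have KC g : K g -> dotv (g + one) (g + one) <= C.
  move=> /KD gD; have := dotvv_ge0 (g - one).
  rewrite /C !(dotvDl, dotvDr, dotvNl, dotvNr) (dotvC one g); lra.
have Kq' q : orthant q -> exists2 g, K g & dotv q (g + one) <= 0.
  move=> /Kq[g Kg qg]; exists g => //; rewrite dotvDr.
  suff -> : dotv q one = d * \sum_j q 0 j by lra.
  by rewrite mulr_sumr; apply: eq_bigr => j _; rewrite mxE mulrC.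
have C0 : 0 <= C.
  have [|g /KC gC _] := Kq' 0; first by move=> j; rewrite mxE.
  by apply: le_trans gC; exact: dotvv_ge0.
have e0 : 0 < d - d' by lra.
pose T := (Num.truncn (C / (d - d') ^+ 2)).+1.
have CT : C < T%:R * (d - d') ^+ 2.
  by rewrite -ltr_pdivrMr ?exprn_gt0// truncnS_gt.
have T0 : 0 < T%:R :> R by rewrite ltr0n.
have [s [sT sK sC]] := approachability _ _ _ KC Kq' T.
exists s; split => //; first by rewrite sT.
move=> j; rewrite sT leNgt; apply/negP => big.
have : Num.max 0 (\sum_(g <- s) g 0 j + T%:R * d) ^+ 2 <= T%:R * C.
  apply: le_trans sC; rewrite [leRHS](bigD1 j) //= lerDl.
  by apply: sumr_ge0 => k _; exact: sqr_ge0.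
apply/negP; rewrite -ltNge max_r; last first.
  by have := mulr_gt0 T0 e0; lra.
have h1 : T%:R * (d - d') < \sum_(g <- s) g 0 j + T%:R * d by lra.
have h2 : 0 < T%:R * (d - d') by rewrite mulr_gt0.
have h3 : T%:R * C < (T%:R * (d - d')) ^+ 2.
  by rewrite exprMn (expr2 T%:R) -mulrA ltr_pM2l.
by apply: lt_trans h3 _; rewrite ltr_pXn2r// nnegrE ltW// (lt_trans h2).
Qed.

(* Maurey's sampling argument, derandomized. *)
Lemma sampling s (mu : 'rV[R]_l) (D : R) (k : nat) :
  (0 < size s)%N -> \sum_(g <- s) g = (size s)%:R *: mu ->
  (forall g, g \in s -> dotv g g <= D) ->
  exists f : nat -> 'rV[R]_l, (forall i, f i \in s) /\
    dotv (\sum_(i < k) f i - k%:R *: mu) (\sum_(i < k) f i - k%:R *: mu)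
      <= k%:R * D.
Proof.
move=> s0 smu sD.
elim: k => [|k [f [fs fD]]].
  exists (fun=> nth 0 s 0); split; first by move=> i; rewrite mem_nth.
  by rewrite big_ord0 scale0r subrr dotv0 mul0r.
pose w := \sum_(i < k) f i - k%:R *: mu.
have [g gs gw] : exists2 g, g \in s &
    dotv (w + (g - mu)) (w + (g - mu)) <= dotv w w + D.
  (* Averaging over [s]: if every [g] raised the squared norm by more than [D], the sum of the
     increments minus [D] would be positive, yet it is at most a linear expression in the deviations
     [g - mu], which sum to zero. *)
  move: w => w; apply: contrapT => noG.
  have lt g : g \in s -> 0 < 2 * dotv w (g - mu) + dotv g g - 2 * dotv mu g
     + dotv mu mu - D.
    move=> gs; rewrite ltNge; apply/negP => gle; apply: noG; exists g => //.
    move: gle; rewrite !(dotvDl, dotvDr, dotvNl, dotvNr).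
    by rewrite (dotvC mu w) (dotvC g w) (dotvC g mu); lra.
  have : \sum_(g <- s) (2 * dotv w (g - mu) + dotv g g - 2 * dotv mu g
     + dotv mu mu - D) <= \sum_(g <- s) (2 * dotv w (g - mu) - 2 * dotv mu (g - mu)).
    rewrite big_seq [leRHS]big_seq; apply: ler_sum => g /sD gD.
    have := dotvv_ge0 mu.
    by rewrite !(dotvDl, dotvDr, dotvNl, dotvNr); lra.
  have -> : \sum_(g <- s) (2 * dotv w (g - mu) - 2 * dotv mu (g - mu)) = 0.
    have smu0 : \sum_(g <- s) (g - mu) = 0.
      by rewrite sumrB smu big_const_seq count_predT iter_addr_0 scaler_nat subrr.
    by rewrite sumrB -!mulr_sumr -!dotv_sumr smu0 !dotv0 !mulr0 subrr.
  apply/negP; rewrite -ltNge.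
  case: s s0 lt {smu sD fs noG} => // g s _ lt.
  rewrite big_cons ltr_pwDl ?lt ?mem_head// big_seq sumr_ge0// => g' g's.
  by rewrite ltW// lt// inE g's orbT.
exists (fun i => if (i < k)%N then f i else g); split.
  by move=> i; case: ifP.
rewrite big_ord_recr /= ltnn (eq_bigr (fun i : 'I_k => f i)); last first.
  by move=> i _; rewrite ltn_ord.
rewrite (_ : _ - _ = w + (g - mu)); last first.
  by rewrite /w -natr1 scalerDl scale1r opprD addrACA.
by rewrite -natr1 mulrDl mul1r; apply: le_trans gw _; rewrite lerD2r.
Qed.

(* Averaging costs [sqrt (k * D)] per coordinate, which the gap [k * d'] pays. *)
Lemma sampling_le0 K (D d d' : R) (k : nat) : 0 <= d' -> d' < d ->
  D <= k%:R * d' ^+ 2 -> (forall g, K g -> dotv g g <= D) ->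
  (forall q, orthant q -> exists2 g, K g & dotv q g <= - d * \sum_j q 0 j) ->
  exists f : nat -> 'rV[R]_l, (forall i, K (f i)) /\
    forall j, (\sum_(i < k) f i) 0 j <= 0.
Proof.
move=> d0 dd Dk KD Kq.
have [s [s0 sK sd]] := approachability_mean _ _ _ _ dd KD Kq.
pose mu := (size s)%:R^-1 *: \sum_(g <- s) g.
have sR : 0 < (size s)%:R :> R by rewrite ltr0n.
have smu : \sum_(g <- s) g = (size s)%:R *: mu.
  by rewrite scalerA divff ?scale1r// gt_eqF.
have [f [fs fD]] := sampling _ _ D k s0 smu (fun g gs => KD _ (sK _ gs)).
exists f; split => [i|j]; first exact: sK.
have muj : mu 0 j <= - d'.
  by rewrite mxE summxE mulrC ler_pdivrMr.
set F := \sum_(i < k) f i.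
have Fj : (F 0 j - k%:R * mu 0 j) ^+ 2 <= k%:R * D.
  by apply: le_trans fD; apply: le_trans (sqr_le_dotvv _ j); rewrite !mxE.
have k0 : 0 <= k%:R :> R by rewrite ler0n.
have kd : k%:R * D <= (k%:R * d') ^+ 2.
  by rewrite exprMn (expr2 k%:R) -mulrA ler_wpM2l.
have h1 : `|F 0 j - k%:R * mu 0 j| <= k%:R * d'.
  rewrite -(@ler_pXn2r _ 2) ?nnegrE ?mulr_ge0// real_normK ?num_real//.
  exact: le_trans Fj kd.
have h2 := ler_wpM2l k0 muj.
by move: h1; rewrite ler_norml => /andP[_]; lra.
Qed.

End Averaging.

(** * Directional derivatives relative to the orthant *)

Section Gradient.
Context {R : realType} {l : nat}.
Implicit Types (u : 'rV[R]_l -> R) (x y v w g : 'rV[R]_l).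

Lemma orthant_segment x v s : orthant x -> orthant (x + v) -> 0 <= s <= 1 ->
  orthant (x + s *: v).
Proof.
move=> x0 xv0 /andP[s0 s1] j; have := x0 j; have := xv0 j.
rewrite !mxE => h1 h2.
have -> : x 0 j + s * v 0 j = (1 - s) * x 0 j + s * (x 0 j + v 0 j) by ring.
by rewrite addr_ge0// mulr_ge0// subr_ge0.
Qed.

Lemma gradient_directional u x v g e : is_gradient u x g ->
  orthant x -> orthant (x + v) -> 0 < e ->
  exists2 s, 0 < s <= 1 & `|u (x + s *: v) - u x - s * dotv g v| <= s * e.
Proof.
move=> gx x0 xv0 e0; have [->|vn0] := eqVneq v 0.
  exists 1; first by rewrite ltr01 lexx.
  by rewrite scaler0 addr0 dotv0 mulr0 !subrr normr0 mul1r ltW.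
have v0 := enorm_gt0 _ vn0.
have /cvgrPdist_lt /(_ (e / enorm v)) := gx; rewrite divr_gt0// => /(_ isT).
rewrite near_withinE near_withinE => /nbhs_ballP[d /= d0 dP].
(* The ball of radius [d] is for the maximum norm, which the Euclidean norm dominates; the factor
   1/2 makes the inclusion strict. *)
pose s := Num.min 1 (d / 2 / enorm v).
have s0 : 0 < s by rewrite lt_min ltr01 !divr_gt0.
have s1 : s <= 1 by rewrite ge_min lexx.
have sd : s * enorm v < d.
  apply: (@le_lt_trans _ _ (d / 2)); last by rewrite ltr_pdivrMr//; lra.
  by rewrite -ler_pdivlMr// ge_min lexx orbT.
exists s; first by rewrite s0.
have xs : x + s *: v - x = s *: v by rewrite addrC addKr.
have : `|0 - (u (x + s *: v) - u x - dotv g (x + s *: v - x)) /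
     enorm (x + s *: v - x)| < e / enorm v.
  apply: dP.
  - rewrite /ball /= /mx_ball; split=> // i j; rewrite ord1 /ball /= !mxE opprD addNKr.
    rewrite normrN normrM gtr0_norm//; apply: le_lt_trans sd.
    rewrite ler_pM2l// -(@ler_pXn2r _ 2) ?nnegrE ?enorm_ge0//.
    by rewrite real_normK ?num_real// enorm_sqr sqr_le_dotvv.
  - rewrite -subr_eq0 xs scaler_eq0 negb_or vn0 andbT gt_eqF//.
  - by apply: orthant_segment => //; rewrite ltW.
rewrite xs enormZ ?(ltW s0)// dotvZr sub0r normrN normrM normfV.
rewrite (@gtr0_norm _ (s * _)) ?mulr_gt0// ltr_pdivrMr ?mulr_gt0//.
by rewrite [X in _ < X](_ : _ = s * e) => [/ltW//|]; field; rewrite gt_eqF.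
Qed.

Lemma gradient_le u x v g c : is_gradient u x g ->
  orthant x -> orthant (x + v) ->
  (forall s, 0 < s <= 1 -> u (x + s *: v) <= u x + s * c) -> dotv g v <= c.
Proof.
move=> gx x0 xv0 uc; rewrite leNgt; apply/negP => lt.
(* An error of half the gap still leaves a growth rate above [c]. *)
have [|s s01] := gradient_directional _ _ _ _ ((dotv g v - c) / 2) gx x0 xv0.
  by lra.
have := uc _ s01; case/andP: s01 => s0 _; rewrite ler_norml => h /andP[+ _].
by move: lt; rewrite -subr_gt0 => /(mulr_gt0 s0); lra.
Qed.

Lemma gradient_ge u x v g c : is_gradient u x g ->
  orthant x -> orthant (x + v) ->
  (forall s, 0 < s <= 1 -> u x + s * c <= u (x + s *: v)) -> c <= dotv g v.
Proof.
move=> gx x0 xv0 uc; rewrite leNgt; apply/negP => lt.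
have [|s s01] := gradient_directional _ _ _ _ ((c - dotv g v) / 2) gx x0 xv0.
  by lra.
have := uc _ s01; case/andP: s01 => s0 _; rewrite ler_norml => h /andP[_].
by move: lt; rewrite -subr_gt0 => /(mulr_gt0 s0); lra.
Qed.

Lemma gradientP u x : continuously_differentiable u -> orthant x ->
  is_gradient u x (gradient u x).
Proof. by move=> [+ _] x0 => /(_ _ x0)/xgetPex; exact. Qed.

Lemma strictly_monotonic_le u x y : strictly_monotonic u ->
  orthant x -> (forall j, x 0 j <= y 0 j) -> u x <= u y.
Proof.
move=> um x0 xy; have [->//|/eqP neq] := eqVneq x y.
by apply/ltW/um => // j; exact: le_trans (xy j).
Qed.

End Gradient.

(** * Quadratic gains from strong concavity *)

Section StrongConcavity.
Context {R : realType} {l : nat}.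
Variables (u : 'rV[R]_l -> R) (alpha : R) (A : set 'rV[R]_l).
Hypothesis u_mono : strictly_monotonic u.
Hypothesis u_C1 : continuously_differentiable u.
Hypothesis u_sconcave : strongly_concave_within alpha A u.
Implicit Types (x y v w : 'rV[R]_l).

Lemma strong_monotonicity x w : A x -> A (x - w) -> orthant w ->
  orthant (x - w) -> u (x - w) + alpha / 2 * dotv w w <= u x.
Proof.
move=> Ax Axw w0 xw0.
have x0 : orthant x.
  by move=> j; have := w0 j; have := xw0 j; rewrite !mxE; lra.
have := u_sconcave _ _ Ax Axw x0 xw0.
have -> : x - w - x = - w by rewrite addrC addKr.
rewrite enorm_sqr dotvNl !dotvNr opprK.
have : dotv (gradient u x) (- w) <= 0.
  apply: (gradient_le _ _ _ _ _ (gradientP _ _ u_C1 x0) x0 xw0) => s /andP[s0 s1].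
  rewrite mulr0 addr0; apply: strictly_monotonic_le => // [|j].
    by apply: orthant_segment => //; rewrite (ltW s0).
  by rewrite !mxE; have := mulr_ge0 (ltW s0) (w0 j); lra.
rewrite dotvNr; lra.
Qed.

(** Strong concavity is applied at the intermediate point towards both ends; with weights [1 - a]
    and [a] the gradient terms cancel. *)
Lemma strong_concavity_segment x v a : A x -> A (x + v) -> A (x + a *: v) ->
  orthant x -> orthant (x + v) -> 0 <= a <= 1 ->
  (1 - a) * u x + a * u (x + v) + alpha / 2 * (a * (1 - a)) * dotv v v
    <= u (x + a *: v).
Proof.
move=> Ax Axv Az x0 xv0 a01.
have z0 := orthant_segment _ _ _ x0 xv0 a01.
have := u_sconcave _ _ Az Ax z0 x0; have := u_sconcave _ _ Az Axv z0 xv0.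
set g := gradient u _; set z := x + a *: v.
have -> : x + v - z = (1 - a) *: v.
  by apply/rowP => j; rewrite !mxE; ring.
have -> : x - z = (- a) *: v.
  by apply/rowP => j; rewrite !mxE; ring.
rewrite !enorm_sqr !(dotvZl, dotvZr); case/andP: a01 => a0 a1.
move: (dotv g v) (dotv v v) (u z) (u x) (u (x + v)) => gv vv uz ux uy h1 h2.
have h3 : 0 <= 1 - a by lra.
have := ler_wpM2l a0 h1; have := ler_wpM2l h3 h2; lra.
Qed.

End StrongConcavity.

(** * Replacing a remote bundle by one near the endowment [e] *)

Section FarBundle.
Context {R : realType} {l : nat}.
Variables (u : 'rV[R]_l -> R) (alpha : R) (A : set 'rV[R]_l) (e : 'rV[R]_l).
Hypothesis u_mono : strictly_monotonic u.
Hypothesis u_C1 : continuously_differentiable u.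
Hypothesis u_sconcave : strongly_concave_within alpha A u.
Hypothesis alpha_gt0 : 0 < alpha.
Hypothesis e_ge0 : orthant e.
(** At squared distance [2 / alpha] the quadratic gain [alpha / 2 * |w|^2] reaches 1, the length of
    the normalized utility range. *)
Hypothesis A_ball : forall z, dotv (z - e) (z - e) <= 2 / alpha -> A z.
Hypothesis u_ge0 : forall b, orthant b -> (forall j, b 0 j <= e 0 j) -> 0 <= u b.
Hypothesis u_lt1 : u e < 1.

(** A longer [w] could be shrunk to squared length exactly [2 / alpha], which stays in [A]; strong
    monotonicity would then give [u e >= u (e - w') + 1 >= 1]. *)
Lemma subendowment_bound w : orthant w -> orthant (e - w) ->
  dotv w w <= 2 / alpha.
Proof.
move=> w0 ew0; rewrite leNgt; apply/negP => big.
have a2 : 0 < 2 / alpha by rewrite divr_gt0.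
have ww : 0 < dotv w w by exact: lt_trans big.
pose t := Num.sqrt (2 / alpha / dotv w w).
have t2 : t ^+ 2 * dotv w w = 2 / alpha.
  by rewrite sqr_sqrtr ?divr_ge0 ?ltW// divfK// gt_eqF.
have t0 : 0 <= t by exact: sqrtr_ge0.
have t1 : t <= 1.
  rewrite -(@ler_pXn2r _ 2) ?nnegrE// expr1n -(ler_pM2r ww) t2; lra.
pose w' := t *: w.
have w'0 : orthant w' by move=> j; rewrite mxE mulr_ge0.
have ew'0 : orthant (e - w').
  by rewrite /w' -scalerN; apply: orthant_segment => //; rewrite t0.
have w'w' : dotv w' w' = 2 / alpha.
  by rewrite dotvZl dotvZr -t2; ring.
have := strong_monotonicity _ _ _ u_mono u_C1 u_sconcave e w'.
rewrite w'w' => /(_ _ _ w'0 ew'0).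
have Ae : A e by apply: A_ball; rewrite subrr dotv0 ltW.
have Aew : A (e - w').
  by apply: A_ball; rewrite addrC addKr dotvNl dotvNr opprK w'w'.
move=> /(_ Ae Aew).
have : 0 <= u (e - w').
  by apply: u_ge0 => // j; have := w'0 j; rewrite !mxE; lra.
have -> : alpha / 2 * (2 / alpha) = 1 by field; rewrite gt_eqF.
by have := u_lt1; lra.
Qed.

(* Writing [y - e = v^+ - v^-], the bundle [m = e - (2/3) v^- + q v^+] with
   [q <= 2/3] is at most 2/3 as expensive relative to [e].  Starting from
   [e - v^-], where [u >= 0], strong concavity brings a gain of
   [(alpha/2) (5/9) |v^-|^2] along [v^-] and of [(alpha/2) q^2 |v^+|^2]
   along [v^+]; [q] is chosen so that [m] is at distance [sqrt (2/alpha)]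
   of [e], and then the total gain is at least 1. *)
Lemma far_bundle_replacement (p y : 'rV[R]_l) : orthant p -> orthant y ->
  9 / (2 * alpha) < dotv (y - e) (y - e) ->
  exists m, [/\ orthant m, 1 <= u m, dotv (m - e) (m - e) <= 2 / alpha &
    dotv p (m - e) <= 2 / 3 * dotv p (y - e)].
Proof.
move=> p0 y0 far.
pose vp : 'rV[R]_l := \row_j Num.max 0 (y 0 j - e 0 j).
pose vn : 'rV[R]_l := \row_j Num.max 0 (e 0 j - y 0 j).
have vpn j : [/\ 0 <= vp 0 j, 0 <= vn 0 j, vp 0 j * vn 0 j = 0,
    vn 0 j <= e 0 j & y 0 j - e 0 j = vp 0 j - vn 0 j].
  have := e_ge0 j; have := y0 j; rewrite !mxE.
  have [?|?] := leP 0 (y 0 j - e 0 j); have [?|?] := leP 0 (e 0 j - y 0 j);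
    by split; nra.
have vp0 : orthant vp by move=> j; case: (vpn j).
have vn0 : orthant vn by move=> j; case: (vpn j).
have evn0 : orthant (e - vn).
  by move=> j; case: (vpn j) => _ _ _ + _; rewrite !mxE; lra.
have vpvn : dotv vp vn = 0.
  by apply: big1 => j _; case: (vpn j).
have vE : y - e = vp - vn.
  by apply/rowP => j; case: (vpn j) => _ _ _ _; rewrite !mxE.
clearbody vp vn.
have vnvn := subendowment_bound _ vn0 evn0.
have vv : dotv (y - e) (y - e) = dotv vp vp + dotv vn vn.
  by rewrite vE !(dotvDl, dotvDr, dotvNl, dotvNr) (dotvC vn vp) vpvn; ring.
have a2 : 0 < 2 / alpha by rewrite divr_gt0.
have D2 : 9 / (2 * alpha) = 9 / 4 * (2 / alpha) by field; rewrite gt_eqF.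
rewrite D2 vv in far.
have vnvn0 := dotvv_ge0 vn.
have vpvp0 : 0 < dotv vp vp by lra.
pose q := Num.sqrt ((2 / alpha - 4 / 9 * dotv vn vn) / dotv vp vp).
have q0 : 0 <= q by exact: sqrtr_ge0.
have q2 : q ^+ 2 * dotv vp vp = 2 / alpha - 4 / 9 * dotv vn vn.
  rewrite sqr_sqrtr ?divfK ?gt_eqF//; apply: divr_ge0; lra.
(* After multiplication by [|vp|^2] this reads [|vp|^2 + |vn|^2 >= 9/4 * (2 / alpha)], the assumed
   remoteness of [y]. *)
have qle : q <= 2 / 3.
  rewrite -(@ler_pXn2r _ 2) ?nnegrE// -(ler_pM2r vpvp0) q2; lra.
clearbody q.
pose m0 := e + (2 / 3) *: (- vn).
pose m := m0 + q *: vp.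
have mE : m - e = q *: vp - (2 / 3) *: vn.
  by apply/rowP => j; rewrite !mxE; ring.
have mm : dotv (m - e) (m - e) = 2 / alpha.
  rewrite mE !(dotvDl, dotvDr, dotvNl, dotvNr, dotvZl, dotvZr) (dotvC vn vp).
  by rewrite vpvn; lra.
have m0E : m0 - e = (2 / 3) *: (- vn) by rewrite /m0 addrC addKr.
have a23 : 0 <= (2 / 3 : R) <= 1 by apply/andP; split; lra.
have Am : A m by apply: A_ball; rewrite mm.
have Am0 : A m0.
  apply: A_ball; rewrite m0E !(dotvNl, dotvNr, dotvZl, dotvZr); lra.
have Ae : A e by apply: A_ball; rewrite subrr dotv0 ltW.
have Aevn : A (e - vn).
  by apply: A_ball; rewrite addrC addKr dotvNl dotvNr opprK.
have m00 : orthant m0.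
  exact: orthant_segment.
have qvp0 : orthant (q *: vp) by move=> j; rewrite mxE mulr_ge0.
have mm0 : m - q *: vp = m0 by rewrite /m addrK.
exists m; split.
- by move=> j; have := m00 j; have := qvp0 j; rewrite !mxE; lra.
- have uvn : 0 <= u (e - vn).
    by apply: u_ge0 => // j; have := vn0 j; rewrite !mxE; lra.
  have h1 := strong_monotonicity _ _ _ u_mono u_C1 u_sconcave _ _ Ae Aevn vn0 evn0.
  have h2 : u m0 + alpha / 2 * dotv (q *: vp) (q *: vp) <= u m.
    rewrite -mm0; apply: (strong_monotonicity _ _ _ u_mono u_C1 u_sconcave) => //.
      by rewrite mm0.
    by rewrite mm0.
  (* The 5/9 is 1/3 from the weight of [u e] plus 2/9 from the segment; the move along [vp] adds
     [1 - (alpha/2) (4/9) |vn|^2], so a surplus of [(alpha/2) (1/9) |vn|^2] remains. *)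
  have := strong_concavity_segment _ _ _ u_sconcave e (- vn) (2 / 3) Ae Aevn Am0
    e_ge0 evn0.
  rewrite -/m0 !(dotvNl, dotvNr) opprK => /(_ a23).
  have a1 : alpha / 2 * (2 / alpha) = 1 by field; rewrite gt_eqF.
  move: h2; rewrite dotvZl dotvZr (mulrA q) -(expr2 q) q2 mulrBr a1.
  have : 0 <= alpha / 2 * dotv vn vn by rewrite mulr_ge0// divr_ge0 ?ltW.
  move: h1; lra.
- by rewrite mm.
- rewrite mE vE !(dotvDr, dotvNr, dotvZr).
  have := ler_wpM2r (dotv_ge0 _ _ p0 vp0) qle; lra.
Qed.

End FarBundle.

(** * Blocking coalitions and supporting prices *)

Section Economies.
Context {R : realType} {l : nat} {I : finType}.
Variables (E : economy R l I) (x : I -> 'rV[R]_l).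
Hypothesis u_mono : forall i, strictly_monotonic (util E i).
Hypothesis x_alloc : allocation E x.

Definition preferred_trade : set 'rV[R]_l := [set g | exists i y,
  [/\ orthant y, util E i (x i) < util E i y & g = y - endow E i]].

Lemma replica_blocks (n k : nat) (f : nat -> 'rV[R]_l) :
  (0 < k <= n)%N -> (forall m, preferred_trade (f m)) ->
  (forall j, (\sum_(m < k) f m) 0 j <= 0) ->
  exists S : {set 'I_n * I}, (#|S| <= k)%N /\ (0 < #|S|)%N /\
    blocks (replica n E) S (replicate (n := n) x).
Proof.
move=> /andP[k0 kn] fP f0.
have [F FP] := choice (P := fun m (iy : I * 'rV[R]_l) =>
    [/\ orthant iy.2, util E iy.1 (x iy.1) < util E iy.1 iy.2 &
        f m = iy.2 - endow E iy.1])
  (fun m => let: ex_intro i (ex_intro y iy) := fP m in ex_intro _ (i, y) iy).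
pose e (m : 'I_k) : 'I_n * I := (widen_ord kn m, (F m).1).
have e_inj : injective e.
  by move=> m m' [mm' _]; apply: val_inj.
pose c : 'rV[R]_l := - (k%:R^-1 *: \sum_(m < k) f m).
have c0 : orthant c.
  by move=> j; rewrite !mxE oppr_ge0 mulr_ge0_le0.
(* The default 0 is only taken outside the coalition. *)
pose Y it : 'rV[R]_l := if [pick m | e m == it] is Some m then (F m).2 + c else 0.
have Ye m : Y (e m) = (F m).2 + c.
  rewrite /Y; case: pickP => [m' /eqP/e_inj -> //|/(_ m)].
  by rewrite eqxx.
exists (imset e (mem 'I_k)); rewrite card_imset// card_ord; split => //.
split=> //; exists Y; split; [split|].
- move=> _ /imsetP[m _ ->]; rewrite Ye => j; rewrite mxE.
  by have [/(_ j) + _ _] := FP m; have := c0 j => ? ?; rewrite addr_ge0.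
- rewrite !big_imset /=; try by move=> ? ? _ _; exact: e_inj.
  rewrite (eq_bigr _ (fun m _ => Ye m)) big_split /= sumr_const card_ord.
  rewrite /c mulNrn -scaler_nat scalerA divff ?pnatr_eq0 ?gtn_eqF// scale1r.
  rewrite -sumrB; apply: eq_bigr => m _.
  by have [_ _ ->] := FP m; rewrite opprB addrC subrK.
- move=> _ /imsetP[m _ ->]; rewrite Ye /replicate /=.
  have [y0 lt _] := FP m; apply: (lt_le_trans lt).
  by apply: strictly_monotonic_le => // j; rewrite mxE lerDl.
Qed.

(** Adding [s] units of every good to [x i] gives a preferred bundle and costs only [s] more, since
    prices sum to 1; then [s] tends to 0. *)
Lemma budget_lower_bound p d i : simplex p ->
  (forall y, orthant y -> util E i (x i) < util E i y ->
     dotv p (endow E i) - d < dotv p y) ->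
  dotv p (endow E i) - d <= dotv p (x i).
Proof.
move=> [p0 p1] py; apply/ler_addgt0Pr => s s0.
pose y := x i + const_mx s.
have xi0 : orthant (x i) := x_alloc.1 i.
have xy j : x i 0 j < y 0 j by rewrite !mxE ltrDl.
have y0 : orthant y by move=> j; apply: le_trans (ltW (xy j)).
have lt : util E i (x i) < util E i y.
  apply: u_mono => // [j|xy0]; first exact: ltW.
  (* A good exists because the coordinates of [p] sum to 1. *)
  have [j _|p00] := pickP (fun j : 'I_l => true).
    by have := xy j; rewrite -xy0 ltxx.
  by move: p1; rewrite big_pred0// => /eqP; rewrite eq_sym oner_eq0.
apply: (le_trans (ltW (py y y0 lt))); rewrite dotvDr lerD2l.
rewrite /dotv (eq_bigr (fun j => s * p 0 j)) -?mulr_sumr ?p1 ?mulr1//.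
by move=> j _; rewrite mxE mulrC.
Qed.

(** With [d = eps / #|I|], the net values shifted by [d] are nonnegative and sum to [eps], so none
    exceeds [eps]. *)
Lemma walrasian_of_supporting_price eps p : 0 < eps -> simplex p ->
  (forall i y, orthant y -> util E i (x i) < util E i y ->
     dotv p (endow E i) - eps / #|I|%:R < dotv p y) ->
  walrasian_equilibrium E eps p x.
Proof.
move=> eps0 p0 py; split => // i.
have low k := budget_lower_bound p _ k p0 (py k).
have I0 : (0 < #|I|)%N by apply/card_gt0P; exists i.
have IR : 0 < #|I|%:R :> R by rewrite ltr0n.
have I1 : 1 <= #|I|%:R :> R by rewrite ler1n.
have dE : eps / #|I|%:R * #|I|%:R = eps by rewrite divfK// gt_eqF.
set d := eps / _ in low dE.
have d0 : 0 < d by rewrite divr_gt0.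
rewrite ler_norml; apply/andP; split; first by have := low i; nra.
have : \sum_k (dotv p (x k) - dotv p (endow E k) + d) = eps.
  rewrite big_split /= sumrB -!dotv_sumr x_alloc.2 subrr add0r.
  by rewrite sumr_const -mulr_natr.
rewrite (bigD1 i) //=.
have : 0 <= \sum_(k | k != i) (dotv p (x k) - dotv p (endow E k) + d).
  by apply: sumr_ge0 => k _; have := low k; lra.
lra.
Qed.

(** Consumer [k] absorbs what [i] gives up. This brings bundles below an endowment under the
    normalization of utilities. *)
Lemma subendowment_allocation i k b : k != i -> orthant b ->
  (forall j, b 0 j <= endow E i 0 j) -> exists2 z, allocation E z & z i = b.
Proof.
move=> ki b0 be.
exists (fun m => if m == i then b else
  if m == k then endow E k + (endow E i - b) else endow E m); last first.
  by rewrite eqxx.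
split=> [m|].
  case: eqP => // _; case: eqP => _; last exact: endow_ge0.
  by move=> j; have := endow_ge0 E k j; have := be j; rewrite !mxE; lra.
rewrite (bigD1 i) //= eqxx (bigD1 k) //= (negPf ki) eqxx.
rewrite [RHS](bigD1 i) //= [in RHS](bigD1 k) //= !addrA.
congr (_ + _); first by apply/rowP => j; rewrite !mxE; ring.
by apply: eq_bigr => m /andP[/negPf-> /negPf->].
Qed.

End Economies.
Arguments preferred_trade {R l I} E x.

Lemma core_supporting_price {R : realType} {l : nat} {I : finType}
    (E : economy R l I) x (n k : nat) (D d d' : R) :
  (forall i, strictly_monotonic (util E i)) -> (0 < l)%N -> (0 < k <= n)%N ->
  0 <= d' -> d' < d -> D <= k%:R * d' ^+ 2 ->
  in_core (replica n E) k (replicate (n := n) x) ->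
  exists2 p, simplex p & forall g, preferred_trade E x g -> dotv g g <= D ->
    - d < dotv p g.
Proof.
move=> um l0 kn d0 dd Dk [_ core]; apply: contrapT => noP.
have simp (p : 'rV[R]_l) : simplex p ->
    exists2 g, preferred_trade E x g /\ dotv g g <= D & dotv p g <= - d.
  move=> p0; apply: contrapT => noG; apply: noP; exists p => // g Pg gD.
  by rewrite ltNge; apply/negP => le; apply: noG; exists g.
have Kq q : orthant q -> exists2 g, preferred_trade E x g /\ dotv g g <= D &
    dotv q g <= - d * \sum_j q 0 j.
  move=> q0; have : 0 <= \sum_j q 0 j by apply: sumr_ge0.
  rewrite le_eqVlt => /orP[/eqP s0|s0].
    (* For [q = 0] any admissible trade will do; a vertex of the simplex, taken as price, provides
       one. *)
    have qz j : q 0 j = 0.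
      have /eqP := esym s0; rewrite psumr_eq0// => /allP/(_ j).
      by rewrite mem_index_enum => /(_ isT)/eqP.
    have [|g Kg _] := simp (delta_mx 0 (Ordinal l0)).
      split=> [j|]; first by rewrite mxE ler0n.
      rewrite (bigD1 (Ordinal l0)) //= mxE !eqxx big1 ?addr0// => j /negPf jl.
      by rewrite mxE jl andbF.
    exists g => //; rewrite -s0 mulr0 /dotv big1// => j _.
    by rewrite qz mul0r.
  have [|g Kg] := simp ((\sum_j q 0 j)^-1 *: q).
    split=> [j|]; first by rewrite mxE mulr_ge0// invr_ge0 ltW.
    rewrite (eq_bigr (fun j => (\sum_j q 0 j)^-1 * q 0 j)).
      by rewrite -mulr_sumr mulVf// gt_eqF.
    by move=> j _; rewrite mxE.
  rewrite dotvZl mulrC ler_pdivrMr// => h; by exists g.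
have [f [fK f0]] := sampling_le0
  [set g | preferred_trade E x g /\ dotv g g <= D]
  D d d' k d0 dd Dk (fun g Kg => Kg.2) Kq.
have [S [Sk [S0 Sb]]] := replica_blocks _ _ um _ _ _ kn (fun m => (fK m).1) f0.
exact: core Sb.
Qed.

(** * Supergradients, their signs and that of the Lipschitz constant *)

Lemma concave_gradient {R : realType} {l : nat} (u : 'rV[R]_l -> R)
    (x y : 'rV[R]_l) : concave_utility u -> continuously_differentiable u ->
  orthant x -> orthant y -> u y - u x <= dotv (gradient u x) (y - x).
Proof.
move=> uc u1 x0 y0.
have xy : x + (y - x) = y by rewrite addrC subrK.
apply: (gradient_ge _ _ _ _ _ (gradientP _ _ u1 x0) x0).
  by rewrite xy.
move=> s /andP[s0 s1].
have s01 : 0 <= s <= 1 by rewrite (ltW s0).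
have := uc (Itv01 (ltW s0) s1) y x; rewrite !inE => /(_ y0 x0).
rewrite convRE /=.
have -> : conv (Itv01 (ltW s0) s1) (y : convex_lmodType 'rV[R]_l) x
    = x + s *: (y - x).
  by rewrite /conv /= /unstable.onem scalerBl scalerBr scale1r addrCA addrC.
rewrite /unstable.onem; lra.
Qed.

Lemma gradient_ge0 {R : realType} {l : nat} (u : 'rV[R]_l -> R)
    (x : 'rV[R]_l) : strictly_monotonic u -> continuously_differentiable u ->
  orthant x -> orthant (gradient u x).
Proof.
move=> um u1 x0 j.
have d0 (i : 'I_l) : 0 <= (delta_mx 0 j : 'rV[R]_l) 0 i by rewrite mxE ler0n.
have -> : gradient u x 0 j = dotv (gradient u x) (delta_mx 0 j).
  rewrite /dotv (bigD1 j) //= mxE !eqxx mulr1 big1 ?addr0// => i /negPf ij.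
  by rewrite mxE ij andbF mulr0.
apply: (gradient_ge _ _ _ _ _ (gradientP _ _ u1 x0) x0).
  by move=> i; rewrite mxE addr_ge0.
move=> s /andP[s0 _]; rewrite mulr0 addr0.
apply: strictly_monotonic_le => // i; rewrite mxE lerDl.
by rewrite mxE mulr_ge0// ltW.
Qed.

(** Utility grows strictly from 0 to the all-ones bundle. Hence the [lambda] terms in the bounds on
    [r] and [kappa] are nonnegative. *)
Lemma lipschitz_constant_ge0 {R : realType} {l : nat} (u : 'rV[R]_l -> R) c :
  (0 < l)%N -> strictly_monotonic u -> lipschitz_utility c u -> 0 <= c.
Proof.
move=> l0 um ul; pose one : 'rV[R]_l := const_mx 1.
have one0 : orthant one by move=> j; rewrite mxE.
have z0 : orthant (0 : 'rV[R]_l) by move=> j; rewrite mxE.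
have one_neq0 : one <> 0.
  move=> /rowP/(_ (Ordinal l0)); rewrite !mxE; apply/eqP; exact: oner_neq0.
have lt : u 0 < u one.
  apply: um => // [j|/esym//]; rewrite !mxE; exact: ler01.
have := ul _ _ one0 z0; rewrite subr0 => h.
have e0 : 0 < enorm one by apply: enorm_gt0; apply/eqP.
rewrite -(pmulr_lge0 _ e0); apply: le_trans h; exact: normr_ge0.
Qed.

Theorem theorem3p2 (R : realType) (h l : nat) (h_gt0 : (0 < h)%N)
    (l_gt0 : (0 < l)%N) (E : economy R l 'I_h)
    (lambda alpha eps r eta : R) (A : set 'rV[R]_l) (n kappa : nat)
    (x : 'I_h -> 'rV[R]_l)
    (alpha_gt0 : 0 < alpha) (eps_gt0 : 0 < eps)
    (u_cont : forall i, {within orthant, continuous (util E i)})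
    (u_concave : forall i, concave_utility (util E i))
    (u_lip : forall i, lipschitz_utility lambda (util E i))
    (u_mono : forall i, strictly_monotonic (util E i))
    (u_C1 : forall i, continuously_differentiable (util E i))
    (r_gt0 : 0 < r)
    (r_large : 2 * eps * lambda * l%:R / h%:R + 2 <= alpha * r ^+ 2)
    (A_balls : forall i, eball (endow E i) r `<=` A)
    (u_sconcave : forall i, strongly_concave_within alpha A (util E i))
    (eta_gt0 : 0 < eta) (eta_lt1 : eta < 1)
    (u_normalized : forall z, allocation E z ->
       forall i, 0 <= util E i (z i) /\ util E i (z i) < 1 - eta)
    (kappa_gt0 : (0 < kappa)%N) (kappa_le_n : (kappa <= n)%N)
    (kappa_large :
       16 / alpha * (lambda * l%:R * h%:R / eps + h%:R ^+ 2 / eps ^+ 2)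
         <= kappa%:R)
    (x_alloc : allocation E x)
    (x_core : in_core (replica n E) kappa (replicate (n := n) x)) :
  exists p : 'rV[R]_l, walrasian_equilibrium E eps p x.
Proof.
have hR : 0 < h%:R :> R by rewrite ltr0n.
set d := eps / h%:R.
have d0 : 0 < d by rewrite divr_gt0.
case: (ltnP 1 h) => [h2|h1]; last first.
  pose i0 := Ordinal h_gt0.
  have all0 (i : 'I_h) : i = i0.
    by apply: val_inj; apply/eqP; rewrite /= -leqn0 -ltnS (leq_trans (ltn_ord i)).
  have xe : x i0 = endow E i0.
    have := x_alloc.2; rewrite (bigD1 i0) //= [RHS](bigD1 i0) //=.
    by rewrite !big1 ?addr0// => i; rewrite (all0 i) eqxx.
  pose g := gradient (util E i0) (endow E i0).
  have e0 := endow_ge0 E i0.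
  have gP y : orthant y ->
      util E i0 y - util E i0 (endow E i0) <= dotv g (y - endow E i0).
    by move=> y0; apply: concave_gradient.
  have g0 : orthant g by apply: gradient_ge0.
  (* This sum is the derivative along the all-ones direction; it dominates a strict utility gain. *)
  have S0 : 0 < \sum_j g 0 j.
    pose y := endow E i0 + const_mx 1.
    have ey j : endow E i0 0 j < y 0 j by rewrite !mxE ltrDl.
    have y0 : orthant y by move=> j; apply: le_trans (ltW (ey j)).
    have lt : util E i0 (endow E i0) < util E i0 y.
      apply: u_mono => // [j|ye]; first exact: ltW.
      by have := ey (Ordinal l_gt0); rewrite -ye ltxx.
    have := gP y y0; have -> : y - endow E i0 = const_mx 1 by rewrite addrC addKr.
    have -> : dotv g (const_mx 1) = \sum_j g 0 j.
      by apply: eq_bigr => j _; rewrite mxE mulr1.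
    by move=> ug; apply: lt_le_trans ug; rewrite subr_gt0.
  exists ((\sum_j g 0 j)^-1 *: g); apply: walrasian_of_supporting_price => //.
    split=> [j|]; first by rewrite mxE mulr_ge0// invr_ge0 ltW.
    rewrite (eq_bigr (fun j => (\sum_j g 0 j)^-1 * g 0 j)).
      by rewrite -mulr_sumr mulVf// gt_eqF.
    by move=> j _; rewrite mxE.
  move=> i y y0; rewrite (all0 i) xe card_ord -/d => lt.
  have : 0 < dotv g (y - endow E i0).
    by apply: lt_le_trans (gP y y0); rewrite subr_gt0.
  rewrite -(pmulr_rgt0 _ (_ : 0 < (\sum_j g 0 j)^-1)) ?invr_gt0//.
  by rewrite -dotvZl dotvDr dotvNr; lra.
have a2 : 0 < 2 / alpha by rewrite divr_gt0.
have lam0 : 0 <= lambda.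
  exact: lipschitz_constant_ge0 l_gt0 (u_mono (Ordinal h_gt0)) (u_lip _).
have r2 : 2 / alpha <= r ^+ 2.
  rewrite ler_pdivrMr// mulrC; apply: le_trans r_large; rewrite lerDr.
  by do ?[apply: divr_ge0 | apply: mulr_ge0] => //; exact: ltW.
have A_ball i z : dotv (z - endow E i) (z - endow E i) <= 2 / alpha -> A z.
  move=> zr; apply: (A_balls i); rewrite /eball /= enorm_le ?(ltW r_gt0)//.
  exact: le_trans r2.
(* Here [9 / (2 alpha)] is 9/32 of [16 / alpha], and [9/32 < (11/20)^2]. Taking 11/20 below 3/5
   leaves the gap that approachability needs. *)
have kD : 9 / (2 * alpha) <= kappa%:R * (11 / 20 * d) ^+ 2.
  have kd : 16 / alpha <= kappa%:R * d ^+ 2.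
    have -> : d ^+ 2 = (h%:R ^+ 2 / eps ^+ 2)^-1.
      by rewrite /d invf_div expr_div_n.
    rewrite ler_pdivlMr ?divr_gt0 ?exprn_gt0//; apply: le_trans kappa_large.
    rewrite ler_pM2l ?divr_gt0// lerDr.
    by do ?[apply: divr_ge0 | apply: mulr_ge0] => //; exact: ltW.
  have -> : 9 / (2 * alpha) = 9 / 32 * (16 / alpha) by field; rewrite gt_eqF.
  have : 0 < 16 / alpha by rewrite divr_gt0.
  rewrite exprMn; lra.
have d11 : 0 <= 11 / 20 * d by rewrite mulr_ge0// ltW.
have d35 : 11 / 20 * d < 3 / 5 * d by lra.
have kn : (0 < kappa <= n)%N by rewrite kappa_gt0.
have [p p1 pP] := core_supporting_price _ _ _ _ _ _ _ u_mono l_gt0 kn d11 d35 kD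
  x_core.
have endow_alloc : allocation E (endow E).
  by split=> // i; exact: endow_ge0.
exists p; apply: walrasian_of_supporting_price => // i y y0 lt.
rewrite card_ord -/d.
suff : - d < dotv p (y - endow E i) by rewrite dotvDr dotvNr; lra.
have [near|far] := leP (dotv (y - endow E i) (y - endow E i)) (9 / (2 * alpha)).
  have : - (3 / 5 * d) < dotv p (y - endow E i).
    by apply: pP near; exists i, y.
  lra.
have [k ki] : exists k : 'I_h, k != i.
  have [->|i0] := eqVneq i (Ordinal h_gt0); first by exists (Ordinal h2).
  by exists (Ordinal h_gt0); rewrite eq_sym.
have u_ge0 b : orthant b -> (forall j, b 0 j <= endow E i 0 j) ->
    0 <= util E i b.
  move=> b0 be; have [z za <-] := subendowment_allocation E _ _ _ ki b0 be.
  by case: (u_normalized z za i).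
have u_lt1 : util E i (endow E i) < 1.
  by case: (u_normalized _ endow_alloc i); lra.
have [m [m0 um mr pm]] := far_bundle_replacement _ _ _ _ (u_mono i) (u_C1 i)
  (u_sconcave i) alpha_gt0 (endow_ge0 E i) (A_ball i) u_ge0 u_lt1 p y p1.1 y0 far.
(* The price bound applies to [m], whose utility is at least 1. As [m - endow E i] costs at most 2/3
   of [y - endow E i], the latter costs more than [-(9/10) d]. *)
have : - (3 / 5 * d) < dotv p (m - endow E i).
  apply: pP.
    exists i, m; split => //; apply: lt_le_trans um.
    by case: (u_normalized _ x_alloc i); lra.
  apply: (le_trans mr).
  have -> : 9 / (2 * alpha) = 9 / 4 * (2 / alpha) by field; rewrite gt_eqF.
  lra.
lra.
Qed.
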